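(* Fix any $M(t), N(t)\in \widehat{A[t]}$. For any $X\in A$, there exists unique $U(t)\in \widehat{A[t]}$ and unique $X'\in A$ such that \[(X + I_n t + p I_n t^2 M(t))\, U(t) = X' + I_n t + pI_n t^2 N(t).\] Moreover, we have $U(t)\in I_n + p \widehat{A[t]}$ and $X'\equiv X\pmod p$.
   Context: Let $p$ be a prime, fix $n \in \mathbb{Z}_{\geq 1}$, and let $A := \mathrm{M}_n(\mathbb{Z}_p)$ be the (noncommutative for $n\geq 2$) ring of $n\times n$ matrices over the $p$-adic integers, with $I_n$ the identity matrix. Let $A[t]$ and $A[[t]]$ denote the polynomial ring and the formal power series ring over $A$ in a variable $t$ that commutes with $A$, topologized via the product topology induced from the $p$-adic topology on $A$. Define $\widehat{A[t]}$ to be the subring of $A[[t]]$ given by \[\widehat{A[t]} := \Big\{\sum_{l=0}^{\infty}C_l t^l : C_l \in A \text{ and } \lim_{l \to \infty} C_l=0 \text{ ($p$-adically)}\Big\},\] with the subspace topology. *)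

(* Defs.v *)
From HB Require Import structures.
From mathcomp Require Import all_boot all_algebra.
From mathcomp Require Import boolp.

Set Implicit Arguments.
Unset Strict Implicit.
Unset Printing Implicit Defensive.

Import GRing.Theory.
Local Open Scope ring_scope.

Definition padic_red p k (a : 'Z_(p ^ k.+2)) : 'Z_(p ^ k.+1) := inZp a.

(* The p-adic integers are the inverse limit of the rings Z/p^(k+1), k >= 0.
   The exponent starts at 1 because 'Z_1 is Z/2, not the zero ring. The ring
   structure exists for every p : nat, but it is meant for p prime only. *)
Record padic_int (p : nat) := PadicInt {
  residue :> forall k, 'Z_(p ^ k.+1);
  residue_compat : forall k, padic_red (residue k.+1) = residue k }.

Section PadicRing.
Variable p : nat.
Implicit Types x y z : padic_int p.

Lemma padic_intP x y : (forall k, x k = y k) -> x = y.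
Proof.
case: x y => [x cx] [y cy] /= exy.
have {}exy : x = y by exact: functional_extensionality_dep.
by rewrite {}exy in cx *; rewrite (Prop_irrelevance cx cy).
Qed.

HB.instance Definition _ := gen_eqMixin (padic_int p).
HB.instance Definition _ := gen_choiceMixin (padic_int p).

Lemma Zp_trunc_exp_dvd k :
  ((Zp_trunc (p ^ k.+1)).+2 %| (Zp_trunc (p ^ k.+2)).+2)%N.
Proof.
case: p => [|[|q]]; first by rewrite !exp0n.
  by rewrite !exp1n.
rewrite !Zp_cast ?dvdn_exp2l //;
  exact: (@leq_trans (q.+2 ^ 1)%N) (leq_pexp2l _ _).
Qed.

Lemma padic_red0 k : @padic_red p k 0 = 0.
Proof. by apply/val_inj; rewrite /= mod0n. Qed.

Lemma padic_red1 k : @padic_red p k 1 = 1.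
Proof. exact/val_inj. Qed.

Lemma padic_redD k (a b : 'Z_(p ^ k.+2)) :
  padic_red (a + b) = padic_red a + padic_red b.
Proof.
apply/val_inj.
by rewrite /= modn_dvdm ?Zp_trunc_exp_dvd // modnDm.
Qed.

Lemma padic_redM k (a b : 'Z_(p ^ k.+2)) :
  padic_red (a * b) = padic_red a * padic_red b.
Proof.
apply/val_inj.
by rewrite /= modn_dvdm ?Zp_trunc_exp_dvd // modnMm.
Qed.

Lemma padic_redN k (a : 'Z_(p ^ k.+2)) : padic_red (- a) = - padic_red a.
Proof. by apply/eqP; rewrite -addr_eq0 -padic_redD addNr padic_red0. Qed.

Fact add_compat x y k : padic_red (x k.+1 + y k.+1) = x k + y k.
Proof. by rewrite padic_redD !residue_compat. Qed.

Fact opp_compat x k : padic_red (- x k.+1) = - x k.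
Proof. by rewrite padic_redN residue_compat. Qed.

Fact mul_compat x y k : padic_red (x k.+1 * y k.+1) = x k * y k.
Proof. by rewrite padic_redM !residue_compat. Qed.

Definition padic_zero := @PadicInt p (fun=> 0) padic_red0.
Definition padic_one := @PadicInt p (fun=> 1) padic_red1.
Definition padic_add x y := @PadicInt p (fun k => x k + y k) (add_compat x y).
Definition padic_opp x := @PadicInt p (fun k => - x k) (opp_compat x).
Definition padic_mul x y := @PadicInt p (fun k => x k * y k) (mul_compat x y).

Fact padic_addA : associative padic_add.
Proof. by move=> x y z; apply: padic_intP => k /=; rewrite addrA. Qed.

Fact padic_addC : commutative padic_add.
Proof. by move=> x y; apply: padic_intP => k /=; rewrite addrC. Qed.

Fact padic_add0 : left_id padic_zero padic_add.
Proof. by move=> x; apply: padic_intP => k /=; rewrite add0r. Qed.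

Fact padic_addN : left_inverse padic_zero padic_opp padic_add.
Proof. by move=> x; apply: padic_intP => k /=; rewrite addNr. Qed.

Fact padic_mulA : associative padic_mul.
Proof. by move=> x y z; apply: padic_intP => k /=; rewrite mulrA. Qed.

Fact padic_mulC : commutative padic_mul.
Proof. by move=> x y; apply: padic_intP => k /=; rewrite mulrC. Qed.

Fact padic_mul1 : left_id padic_one padic_mul.
Proof. by move=> x; apply: padic_intP => k /=; rewrite mul1r. Qed.

Fact padic_mulD : left_distributive padic_mul padic_add.
Proof. by move=> x y z; apply: padic_intP => k /=; rewrite mulrDl. Qed.

Fact padic_one_neq0 : padic_one != padic_zero.
Proof. by apply/eqP => /(congr1 (fun x => x 0)) /eqP; rewrite /= oner_eq0. Qed.

HB.instance Definition _ := GRing.isZmodule.Build (padic_int p)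
  padic_addA padic_addC padic_add0 padic_addN.
HB.instance Definition _ := GRing.Zmodule_isComNzRing.Build (padic_int p)
  padic_mulA padic_mulC padic_mul1 padic_mulD padic_one_neq0.

End PadicRing.

Record fpseries (R : Type) := FPSeries { fpcoef : nat -> R }.

Notation "{ 'fps' R }" := (fpseries R) (at level 0, format "{ 'fps'  R }").

Section FPSRing.
Variable R : pzRingType.
Implicit Types f g h : {fps R}.

Lemma fpsP f g : (forall l, fpcoef f l = fpcoef g l) -> f = g.
Proof. by case: f g => [f] [g] /= /funext ->. Qed.

HB.instance Definition _ := gen_eqMixin {fps R}.
HB.instance Definition _ := gen_choiceMixin {fps R}.

Definition fpsC (c : R) : {fps R} :=
  FPSeries (fun l => if l is 0 then c else 0).
Definition fpsX : {fps R} := FPSeries (fun l => if l is 1 then 1 else 0).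

Definition fps_add f g := FPSeries (fun l => fpcoef f l + fpcoef g l).
Definition fps_opp f := FPSeries (fun l => - fpcoef f l).
Definition fps_mul f g :=
  FPSeries (fun l => \sum_(i < l.+1) fpcoef f i * fpcoef g (l - i)%N).

Fact fps_addA : associative fps_add.
Proof. by move=> f g h; apply: fpsP => l /=; rewrite addrA. Qed.

Fact fps_addC : commutative fps_add.
Proof. by move=> f g; apply: fpsP => l /=; rewrite addrC. Qed.

Fact fps_add0 : left_id (fpsC 0) fps_add.
Proof. by move=> f; apply: fpsP => -[|l] /=; rewrite add0r. Qed.

Fact fps_addN : left_inverse (fpsC 0) fps_opp fps_add.
Proof. by move=> f; apply: fpsP => -[|l] /=; rewrite addNr. Qed.

Fact fps_mulA : associative fps_mul.
Proof.
move=> f g h; apply: fpsP => l /=.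
pose F j i := fpcoef f j * (fpcoef g (i - j)%N * fpcoef h (l - i)%N).
transitivity (\sum_(j < l.+1) \sum_(i < l.+1 | (j <= i)%N) F j i).
  apply: eq_bigr => j _; rewrite big_distrr /=.
  rewrite -(big_mkord (fun i => (j <= i)%N) (F j)).
  rewrite -(big_mkord xpredT
    (fun i => fpcoef f j * (fpcoef g i * fpcoef h (l - j - i)%N))).
  rewrite -(big_nat_widenl j 0 l.+1 xpredT) //.
  rewrite -[X in _ = \sum_(X <= _ < _) _]add0n big_addn subSn ?leq_ord //.
  by apply: eq_bigr => i _; rewrite /F addnK -subnDA addnC.
rewrite (exchange_big_dep xpredT) //=; apply: eq_bigr => i _.
rewrite big_distrl /= (big_ord_widen_cond l.+1 xpredT
  (fun j => fpcoef f j * fpcoef g (i - j)%N * fpcoef h (l - i)%N)) //.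
by apply: eq_bigr => j _; rewrite /F mulrA.
Qed.

Fact fps_mul1 : left_id (fpsC 1) fps_mul.
Proof.
move=> f; apply: fpsP => l /=; rewrite big_ord_recl /= mul1r subn0.
by rewrite big1 ?addr0 // => i _; rewrite mul0r.
Qed.

Fact fps_mulr1 : right_id (fpsC 1) fps_mul.
Proof.
move=> f; apply: fpsP => l /=; rewrite big_ord_recr /= subnn mulr1.
rewrite big1 ?add0r // => i _; rewrite -(subnSK (ltn_ord i)) /=.
by rewrite mulr0.
Qed.

Fact fps_mulDl : left_distributive fps_mul fps_add.
Proof.
move=> f g h; apply: fpsP => l /=; rewrite -big_split /=.
by apply: eq_bigr => i _; rewrite mulrDl.
Qed.

Fact fps_mulDr : right_distributive fps_mul fps_add.
Proof.
move=> f g h; apply: fpsP => l /=; rewrite -big_split /=.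
by apply: eq_bigr => i _; rewrite mulrDr.
Qed.

HB.instance Definition _ := GRing.isZmodule.Build {fps R}
  fps_addA fps_addC fps_add0 fps_addN.
HB.instance Definition _ := GRing.Zmodule_isPzRing.Build {fps R}
  fps_mulA fps_mul1 fps_mulr1 fps_mulDl fps_mulDr.

End FPSRing.

Arguments fpsX {R}.

Definition eqr_mod (R : pzRingType) (m : nat) (x y : R) :=
  exists z, x - y = m%:R * z.

(* The p-adic topology on R has the ideals p^k R as a basis of
   neighbourhoods of 0. *)
Definition padic_cvg (R : pzRingType) (p : nat) (u : nat -> R) (a : R) :=
  forall k, exists L, forall l, (L <= l)%N -> eqr_mod (p ^ k) (u l) a.

(* For R = M_n(Z_p) this is the ring denoted by A[t] with a wide hat. *)
Definition restricted (R : pzRingType) (p : nat) : {pred {fps R}} :=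
  fun f => `[< padic_cvg p (fpcoef f) 0 >].

Arguments restricted : clear implicits.

Section RestrictedSubring.
Variables (R : pzRingType) (p : nat).

Lemma restrictedP (f : {fps R}) :
  reflect (padic_cvg p (fpcoef f) 0) (f \in restricted R p).
Proof. exact: asboolP. Qed.

Fact restricted_subring : subring_closed (restricted R p).
Proof.
have natC (m : nat) (x : R) : x * m%:R = m%:R * x.
  by rewrite mulr_natl mulr_natr.
split=> [|f g /restrictedP hf /restrictedP hg|f g /restrictedP hf /restrictedP hg].
- apply/restrictedP => k; exists 1%N => -[//|l] _; exists 0.
  by rewrite /= subrr mulr0.
- apply/restrictedP => k; have [Lf hLf] := hf k; have [Lg hLg] := hg k.
  exists (maxn Lf Lg) => l; rewrite geq_max => /andP[/hLf[a ha] /hLg[b hb]].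
  rewrite subr0 in ha; rewrite subr0 in hb.
  by exists (a - b); rewrite subr0 /= ha hb mulrBr.
- apply/restrictedP => k; have [Lf hLf] := hf k; have [Lg hLg] := hg k.
  exists (Lf + Lg)%N => l hl.
  rewrite /eqr_mod subr0 /=; elim/big_ind: _ => [|_ _ [a ->] [b ->]|i _].
  + by exists 0; rewrite mulr0.
  + by exists (a + b); rewrite mulrDr.
  case: (leqP Lf i) => [/hLf[a]|ltif].
    by rewrite subr0 => ->; exists (a * fpcoef g (l - i)%N); rewrite mulrA.
  have /hLg[b] : (Lg <= l - i)%N.
    by rewrite leq_subRL ?leq_ord // (leq_trans _ hl) // leq_add2r ltnW.
  by rewrite subr0 => ->; exists (fpcoef f i * b); rewrite !mulrA natC.
Qed.

HB.instance Definition _ :=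
  GRing.isSubringClosed.Build {fps R} (restricted R p) restricted_subring.

End RestrictedSubring.

(* Main.v *)
(* With S the shift (S U)_l = U_(l+1), comparing coefficients turns the equation
   into X' = X U_0 and (1 + X S) U = 1 + p t (N - M U). On restricted series
   1 + X S is bijective, with inverse K the sum of the (- X S)^k, and K 1 = 1.
   Hence U is a fixed point of U |-> 1 + p K (t (N - M U)), a p-adic
   contraction, and the two congruences modulo p can be read off. *)

Require Import Defs.
From mathcomp Require Import all_boot all_algebra.
From mathcomp Require Import boolp.

Set Implicit Arguments.
Unset Strict Implicit.
Unset Printing Implicit Defensive.

Import GRing.Theory.
Local Open Scope ring_scope.

(** This and [padic_complete] are the input of the fixed-point argument, which runs over a general
    ring; both are later proved for the p-adic integers and passed on to matrices entrywise. *)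
Definition padic_separated (R : pzRingType) (p : nat) :=
  forall x : R, (forall k, eqr_mod (p ^ k) x 0) -> x = 0.

Definition padic_complete (R : pzRingType) (p : nat) :=
  forall u : nat -> R,
    (forall k, exists L, forall l, (L <= l)%N -> eqr_mod (p ^ k) (u l) (u L)) ->
    exists a, padic_cvg p u a.

(** * Calculus of congruences modulo an integer *)

Section Congruences.
Variables (R : pzRingType) (m : nat).
Implicit Types x y z : R.

Lemma eqr_mod_refl x : eqr_mod m x x.
Proof. by exists 0; rewrite subrr mulr0. Qed.

Lemma eqr_mod_sym x y : eqr_mod m x y -> eqr_mod m y x.
Proof. by case=> z e; exists (- z); rewrite mulrN -e opprB. Qed.

Lemma eqr_mod_trans y x z : eqr_mod m x y -> eqr_mod m y z -> eqr_mod m x z.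
Proof.
by case=> a ea [b eb]; exists (a + b); rewrite mulrDr -ea -eb addrA subrK.
Qed.

Lemma eqr_modN x y : eqr_mod m x y -> eqr_mod m (- x) (- y).
Proof. by case=> z e; exists (- z); rewrite mulrN -e opprD. Qed.

Lemma eqr_modD x y x' y' :
  eqr_mod m x y -> eqr_mod m x' y' -> eqr_mod m (x + x') (y + y').
Proof.
by case=> a ea [b eb]; exists (a + b); rewrite mulrDr -ea -eb opprD addrACA.
Qed.

Lemma eqr_modB x y x' y' :
  eqr_mod m x y -> eqr_mod m x' y' -> eqr_mod m (x - x') (y - y').
Proof. by move=> h /eqr_modN; exact: eqr_modD. Qed.

Lemma eqr_modMl z x y : eqr_mod m x y -> eqr_mod m (z * x) (z * y).
Proof.
case=> a e; exists (z * a); rewrite -mulrBr e !mulrA.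
by rewrite mulr_natl mulr_natr.
Qed.

Lemma eqr_mod_subr0 x y : eqr_mod m (x - y) 0 <-> eqr_mod m x y.
Proof. by rewrite /eqr_mod subr0. Qed.

Lemma eqr_mod_sum0 (I : Type) (r : seq I) (F : I -> R) :
  (forall i, eqr_mod m (F i) 0) -> eqr_mod m (\sum_(i <- r) F i) 0.
Proof.
move=> h; elim/big_ind: _ => // [|x y hx hy]; first exact: eqr_mod_refl.
by rewrite -[0]addr0; exact: eqr_modD.
Qed.

(** Source of the contraction: an explicit factor [p] sharpens a congruence. *)
Lemma eqr_mod_natM p x y : eqr_mod m x y -> eqr_mod (p * m) (p%:R * x) (p%:R * y).
Proof. by case=> z e; exists z; rewrite -mulrBr e mulrA natrM. Qed.

End Congruences.

(** * Coefficients and congruences of power series *)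

Lemma fpcoef_natM (R : pzRingType) (m : nat) (f : {fps R}) l :
  fpcoef (m%:R * f) l = m%:R * fpcoef f l.
Proof.
rewrite !mulr_natl; elim: m => [|m IH]; first by rewrite !mulr0n; case: l.
by rewrite !mulrS -IH.
Qed.

Lemma fpcoef_CM (R : pzRingType) (c : R) (f : {fps R}) l :
  fpcoef (fpsC c * f) l = c * fpcoef f l.
Proof.
rewrite /= big_ord_recl /= subn0 big1 ?addr0 // => i _.
by rewrite mul0r.
Qed.

Lemma fpcoef_XM (R : pzRingType) (f : {fps R}) l :
  fpcoef (fpsX * f) l = if l is l'.+1 then fpcoef f l' else 0.
Proof.
case: l => [|l] /=; rewrite big_ord_recl /= mul0r add0r.
  by rewrite big_ord0.
rewrite big_ord_recl /= mul1r subn1 big1 ?addr0 // => i _.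
by rewrite mul0r.
Qed.

Lemma fpcoef_0 (R : pzRingType) l : fpcoef (0 : {fps R}) l = 0.
Proof. by case: l. Qed.

(** Coefficientwise quotients assemble into a series by choice; this quotient lies in [{fps R}] and
    is not claimed to be restricted. *)
Lemma eqr_mod_fps (R : pzRingType) (m : nat) (f g : {fps R}) :
  eqr_mod m f g <-> forall l, eqr_mod m (fpcoef f l) (fpcoef g l).
Proof.
split=> [[h e] l|/choice[h e]].
  by exists (fpcoef h l); rewrite -fpcoef_natM -e.
by exists (FPSeries h); apply: fpsP => l; rewrite fpcoef_natM /= e.
Qed.

Lemma padic_separated_fps (R : pzRingType) (p : nat) :
  padic_separated R p -> padic_separated {fps R} p.
Proof.
move=> sepR f hf; apply: fpsP => l; rewrite fpcoef_0; apply: sepR => k.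
by have /eqr_mod_fps/(_ l) := hf k; rewrite fpcoef_0.
Qed.

Lemma restricted_fpsX (R : pzRingType) (p : nat) : fpsX \in restricted R p.
Proof.
apply/restrictedP => k; exists 2%N => -[|[|l]] //= _; exact: eqr_mod_refl.
Qed.

(** Completeness with an explicit rate, later applied to each coefficient of the iterates so that
    the rate is uniform in the coefficient index. *)
Lemma padic_complete_fast (R : pzRingType) (p : nat) (u : nat -> R) :
  padic_complete R p -> (forall k, eqr_mod (p ^ k) (u k.+1) (u k)) ->
  exists a, forall k, eqr_mod (p ^ k) (u k) a.
Proof.
move=> compR hu.
have hu' k l : (k <= l)%N -> eqr_mod (p ^ k) (u l) (u k).
  move=> /subnK <-; elim: (l - k)%N => [|d IH]; first exact: eqr_mod_refl.
  apply: eqr_mod_trans IH; rewrite addSn.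
  have [z e] := hu (d + k)%N; exists ((p ^ d)%:R * z).
  by rewrite e mulrA -natrM -expnD addnC.
have [k|a ha] := compR u; first by exists k => l; exact: hu'.
exists a => k; have [L hL] := ha k.
(* The index [L + k] is past [k], hence agrees with [u k], and past [L], hence is close to [a]. *)
apply: (@eqr_mod_trans _ _ (u (L + k))).
  by apply/eqr_mod_sym/hu'; rewrite leq_addl.
by apply: hL; rewrite leq_addr.
Qed.

(** * The operator 1 + X S on restricted series *)

Section ShiftOperator.
Variables (R : pzRingType) (p : nat) (X : R).
Implicit Types U W G : {fps R}.

Definition one_add_shift U : {fps R} :=
  FPSeries (fun l => fpcoef U l + X * fpcoef U l.+1).

Lemma one_add_shiftE U l :
  fpcoef (one_add_shift U) l = fpcoef U l + X * fpcoef U l.+1.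
Proof. by []. Qed.

Lemma one_add_shiftD U W :
  one_add_shift (U + W) = one_add_shift U + one_add_shift W.
Proof. by apply: fpsP => l /=; rewrite mulrDr addrACA. Qed.

Lemma one_add_shiftB U W :
  one_add_shift (U - W) = one_add_shift U - one_add_shift W.
Proof. by apply: fpsP => l /=; rewrite mulrDr mulrN opprD addrACA. Qed.

Lemma one_add_shift_natM m U : one_add_shift (m%:R * U) = m%:R * one_add_shift U.
Proof.
apply: fpsP => l; rewrite fpcoef_natM !one_add_shiftE !fpcoef_natM mulrDr; congr (_ + _).
by rewrite !mulrA mulr_natl mulr_natr.
Qed.

Lemma one_add_shift1 : one_add_shift 1 = 1.
Proof. by apply: fpsP => -[|l] /=; rewrite mulr0 addr0. Qed.

(* Iterating [W_l = - X W_(l+1)] pushes the index to where [W] is small. *)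
Lemma one_add_shift_mod0 k W : W \in restricted R p ->
  eqr_mod (p ^ k) (one_add_shift W) 0 -> eqr_mod (p ^ k) W 0.
Proof.
move=> /restrictedP/(_ k)[L hL] /eqr_mod_fps hW; apply/eqr_mod_fps => l.
rewrite fpcoef_0; suff H d : forall l, (L <= d + l)%N -> eqr_mod (p ^ k) (fpcoef W l) 0.
  by apply: (H L); rewrite leq_addr.
elim: d => [|d IH] {}l hl; first exact: hL.
have := hW l; rewrite fpcoef_0 /= => h.
rewrite -[fpcoef W l](addrK (X * fpcoef W l.+1)) -[0]subr0.
apply: eqr_modB => //; rewrite -(mulr0 X).
by apply/eqr_modMl/IH; rewrite addnS.
Qed.

(** A restricted series killed by 1 + X S is divisible by every power of [p], hence zero by
    separatedness. *)
Lemma one_add_shift_inj U W : padic_separated R p ->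
  U \in restricted R p -> W \in restricted R p ->
  one_add_shift U = one_add_shift W -> U = W.
Proof.
move=> sepR rU rW e; apply/eqP; rewrite -subr_eq0; apply/eqP.
apply: padic_separated_fps sepR _ _ => k.
apply: one_add_shift_mod0; first exact: rpredB.
by rewrite one_add_shiftB e subrr; exact: eqr_mod_refl.
Qed.

(* The inverse of [1 + X S] is the geometric series of [- X S]; it converges
   on restricted series since [(S^j G)_l = G_(l+j)] tends to 0 with [j]. *)
Lemma one_add_shift_surj G : padic_separated R p -> padic_complete R p ->
  G \in restricted R p ->
  exists2 W, W \in restricted R p & one_add_shift W = G.
Proof.
move=> sepR compR /restrictedP rG.
pose S l d := \sum_(j < d) (- X) ^+ j * fpcoef G (l + j)%N.
have S0 k L : (forall l, (L <= l)%N -> eqr_mod (p ^ k) (fpcoef G l) 0) ->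
    forall l d, (L <= l)%N -> eqr_mod (p ^ k) (S l d) 0.
  move=> hL l d hl; apply: eqr_mod_sum0 => j; rewrite -(mulr0 ((- X) ^+ j)).
  by apply/eqr_modMl/hL/(leq_trans hl)/leq_addr.
have SD l d e : S l (d + e)%N = S l d + (- X) ^+ d * S (l + d)%N e.
  rewrite /S big_split_ord /= mulr_sumr; congr (_ + _).
  by apply: eq_bigr => j _; rewrite mulrA exprD addnA.
(* Finite form of (1 + X S) W = G: the terms of [S l d.+1] after the first add up to - X times
   [S l.+1 d]. *)
have S1 l d : S l d.+1 + X * S l.+1 d = fpcoef G l.
  rewrite -add1n SD addn1 expr1 mulNr addrNK /S big_ord1.
  by rewrite expr0 mul1r addn0.
have /choice[W hW] l : exists a, padic_cvg p (S l) a.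
  apply: compR => k; have [L hL] := rG k; exists L => d hd.
  rewrite -(subnKC hd) SD -{2}[S l L]addr0; apply: eqr_modD.
    exact: eqr_mod_refl.
  rewrite -(mulr0 ((- X) ^+ L)); apply/eqr_modMl/(S0 _ _ hL).
  by rewrite leq_addl.
exists (FPSeries W).
  apply/restrictedP => k; have [L hL] := rG k; exists L => l hl /=.
  (* The limit agrees modulo [p ^ k] with a partial sum that only involves coefficients of [G] of
     index at least [L]. *)
  have [D hD] := hW l k; apply: eqr_mod_trans (S0 k L hL l D hl).
  exact/eqr_mod_sym/hD.
apply/eqP; rewrite -subr_eq0; apply/eqP.
apply: padic_separated_fps sepR _ _ => k; apply/eqr_mod_subr0/eqr_mod_fps => l.
have [D hD] := hW l k; have [D' hD'] := hW l.+1 k.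
rewrite -(S1 l (D + D')%N) /=; apply/eqr_mod_sym/eqr_modD.
  by apply: hD; rewrite -addnS leq_addr.
by apply/eqr_modMl/hD'; rewrite leq_addl.
Qed.

End ShiftOperator.

(** * Solving the equation by contraction *)

Section FixedPoint.
Variables (R : pzRingType) (p : nat).
Hypotheses (sepR : padic_separated R p) (compR : padic_complete R p).
Variables (X : R) (M N : {fps R}).
Hypotheses (rM : M \in restricted R p) (rN : N \in restricted R p).
Implicit Types U V W : {fps R}.

(** Degree 0 gives the first equation, and degree l + 1 gives coefficient l of the second. Only the
    first involves [X'], so [U] determines [X']. *)
Lemma fps_eqn_coef U X' :
  (fpsC X + fpsX + p%:R * fpsX ^+ 2 * M) * U
      = fpsC X' + fpsX + p%:R * fpsX ^+ 2 * N <->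
  X * fpcoef U 0 = X' /\
  one_add_shift X U = 1 + p%:R * (fpsX * (N - M * U)).
Proof.
(* As [p] is central, one factor t can be pulled out on the left of both sides. *)
have pX (f : {fps R}) : p%:R * fpsX ^+ 2 * f = fpsX * (p%:R * (fpsX * f)).
  by rewrite expr2 !mulrA [fpsX * p%:R]mulr_natr [p%:R * fpsX]mulr_natl.
rewrite !mulrDl -[_ * M * U]mulrA !pX -!addrA -mulrDr.
rewrite -[X in fpsC X' + (X + _)]mulr1 -mulrDr.
have lhs0 : fpcoef (fpsC X * U + fpsX * (U + p%:R * (fpsX * (M * U)))) 0
     = X * fpcoef U 0.
  by rewrite -[LHS]/(fpcoef _ 0 + fpcoef _ 0) fpcoef_CM fpcoef_XM addr0.
have rhs0 : fpcoef (fpsC X' + fpsX * (1 + p%:R * (fpsX * N))) 0 = X'.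
  by rewrite -[LHS]/(fpcoef _ 0 + fpcoef _ 0) fpcoef_XM addr0.
have lhsS l : fpcoef (fpsC X * U + fpsX * (U + p%:R * (fpsX * (M * U)))) l.+1
     = fpcoef (one_add_shift X U + p%:R * (fpsX * (M * U))) l.
  rewrite -[LHS]/(fpcoef _ _ + fpcoef _ _) fpcoef_CM fpcoef_XM.
  rewrite -[RHS]/(_ + _ + fpcoef _ _) -[X in _ + X = _]/(_ + fpcoef _ l).
  by rewrite addrCA addrA.
have rhsS l : fpcoef (fpsC X' + fpsX * (1 + p%:R * (fpsX * N))) l.+1
     = fpcoef (1 + p%:R * (fpsX * N)) l.
  by rewrite -[LHS]/(0 + fpcoef _ _) fpcoef_XM add0r.
rewrite !mulrBr addrA; split=> [e|[e0 eS]].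
  split; first by rewrite -lhs0 e.
  apply/eqP; rewrite eq_sym subr_eq; apply/eqP/fpsP => l.
  by rewrite -lhsS e.
apply: fpsP => -[|l]; first by rewrite lhs0 rhs0.
by rewrite lhsS rhsS eS subrK.
Qed.

Let rG U : U \in restricted R p -> fpsX * (N - M * U) \in restricted R p.
Proof. by move=> rU; rewrite rpredM ?restricted_fpsX ?rpredB ?rpredM. Qed.

Let rG1 U : U \in restricted R p ->
  1 + p%:R * (fpsX * (N - M * U)) \in restricted R p.
Proof. by move=> rU; exact: rpredD (rpred1 _) (rpredM (rpred_nat _ _) (rG rU)). Qed.

Let modG k U W : eqr_mod (p ^ k) U W ->
  eqr_mod (p ^ k.+1) (1 + p%:R * (fpsX * (N - M * U)))
                     (1 + p%:R * (fpsX * (N - M * W))).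
Proof.
move=> h; rewrite expnS; apply: eqr_modD; first exact: eqr_mod_refl.
apply/eqr_mod_natM/eqr_modMl/eqr_modB; first exact: eqr_mod_refl.
exact: eqr_modMl.
Qed.

(* [1 + X S] reflects congruences while the right-hand side gains a factor
   [p]: two solutions congruent modulo [p ^ k] are congruent modulo
   [p ^ k.+1]. *)
Lemma fps_eqn_uniq U W : U \in restricted R p -> W \in restricted R p ->
  one_add_shift X U = 1 + p%:R * (fpsX * (N - M * U)) ->
  one_add_shift X W = 1 + p%:R * (fpsX * (N - M * W)) -> U = W.
Proof.
move=> rU rW eU eW; apply/eqP; rewrite -subr_eq0; apply/eqP.
apply: padic_separated_fps sepR _ _ => k; apply/eqr_mod_subr0.
elim: k => [|k IH]; first by exists (U - W); rewrite mul1r.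
apply/eqr_mod_subr0/(@one_add_shift_mod0 _ _ X); first exact: rpredB.
by rewrite one_add_shiftB eU eW; apply/eqr_mod_subr0/modG.
Qed.

(** Picard iteration from 1: each step applies the inverse of 1 + X S to the right-hand side built
    from the previous iterate. *)
Lemma fps_eqn_exists : exists2 U, U \in restricted R p &
  one_add_shift X U = 1 + p%:R * (fpsX * (N - M * U)).
Proof.
(* Restrictedness is a premise inside the existential, so that choice gives a total map [F]; the
   value 0 off restricted series is a dummy. *)
have /choice[F hF] U : exists W, U \in restricted R p ->
    W \in restricted R p /\
    one_add_shift X W = 1 + p%:R * (fpsX * (N - M * U)).
  case rU: (U \in restricted R p); last by exists 0.
  by have [W rW eW] := one_add_shift_surj X sepR compR (rG1 rU); exists W.
pose u k := iter k F 1.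
have ru k : u k \in restricted R p.
  by elim: k => [|k IH]; [exact: rpred1 | case: (hF _ IH)].
have eu k : one_add_shift X (u k.+1) = 1 + p%:R * (fpsX * (N - M * u k)).
  by case: (hF _ (ru k)).
have cu k : eqr_mod (p ^ k) (u k.+1) (u k).
  elim: k => [|k IH]; first by exists (u 1%N - u 0%N); rewrite mul1r.
  (* The right-hand sides agree modulo [p ^ k.+1] by [modG], and 1 + X S reflects this to the
     iterates. *)
  apply/eqr_mod_subr0/(@one_add_shift_mod0 _ _ X); first exact: rpredB.
  by rewrite one_add_shiftB !eu; apply/eqr_mod_subr0/modG.
have /choice[U hU] l : exists a, forall k, eqr_mod (p ^ k) (fpcoef (u k) l) a.
  by apply: padic_complete_fast => // k; have /eqr_mod_fps := cu k; apply.
have {}hU k : eqr_mod (p ^ k) (u k) (FPSeries U) by apply/eqr_mod_fps => l.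
exists (FPSeries U).
  (* Modulo [p ^ k] the limit has the coefficients of the restricted series [u k]. *)
  apply/restrictedP => k; have /restrictedP/(_ k)[L hL] := ru k.
  exists L => l /hL; apply: eqr_mod_trans.
  by have /eqr_mod_sym/eqr_mod_fps/(_ l) := hU k.
apply/eqP; rewrite -subr_eq0; apply/eqP.
apply: padic_separated_fps sepR _ _ => k; apply/eqr_mod_subr0.
apply: (@eqr_mod_trans _ _ (one_add_shift X (u k))).
  apply/eqr_mod_fps => l; have /eqr_mod_sym/eqr_mod_fps h := hU k.
  by apply: eqr_modD => //; exact: eqr_modMl.
(* Modulo 1 there is nothing to prove; [u k.+1] solves the equation with [u k] on the right, and
   [modG] replaces [u k] by the limit. *)
case: k => [|k]; first by eexists; rewrite mul1r.
by rewrite eu; exact/modG/hU.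
Qed.

(** Take V with (1 + X S) V = t (N - M U). Since 1 + X S fixes 1, it maps [U] and 1 + p V to the
    same series, and injectivity applies. *)
Lemma fps_eqn_mod U : U \in restricted R p ->
  one_add_shift X U = 1 + p%:R * (fpsX * (N - M * U)) ->
  exists2 V, V \in restricted R p & U = 1 + p%:R * V.
Proof.
move=> rU eU; have [V rV eV] := one_add_shift_surj X sepR compR (rG rU).
exists V => //; apply: (@one_add_shift_inj _ _ X) sepR rU _ _.
  exact: rpredD (rpred1 _) (rpredM (rpred_nat _ _) rV).
by rewrite eU one_add_shiftD one_add_shift1 one_add_shift_natM eV.
Qed.

End FixedPoint.

(** * Separatedness and completeness of the p-adic integers *)

Section PadicInt.
Variable p : nat.
Hypothesis p_gt1 : (1 < p)%N.
Implicit Types x y : padic_int p.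

Let Zp_truncE k : ((Zp_trunc (p ^ k.+1)).+2 = p ^ k.+1)%N.
Proof. by rewrite Zp_cast // (leq_trans p_gt1) // -{1}[p]expn1 leq_pexp2l // ltnW. Qed.

Lemma val_inZp_exp k a : val (inZp a : 'Z_(p ^ k.+1)) = (a %% p ^ k.+1)%N.
Proof. by rewrite /= -[in RHS]Zp_truncE. Qed.

(** Iterated compatibility, phrased on natural representatives so that divisibility can be handled
    in [nat]. *)
Lemma residue_mod x j k : (j <= k)%N -> val (x j) = (val (x k) %% p ^ j.+1)%N.
Proof.
move=> /subnK <-; elim: (k - j)%N => [|i ->].
  by rewrite modn_small // -[X in (_ < X)%N]Zp_truncE ltn_ord.
rewrite -(residue_compat x (i + j)) val_inZp_exp modn_dvdm //.
by rewrite dvdn_exp2l // ltnS leq_addl.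
Qed.

Lemma residue_natM m x k : val ((m%:R * x) k) = ((m * val (x k)) %% p ^ k.+1)%N.
Proof.
have -> : (m%:R * x) k = m%:R * x k.
  rewrite !mulr_natl; elim: m => [|m IH]; first by rewrite !mulr0n.
  by rewrite !mulrS -IH.
by rewrite mulr_natl Zp_mulrn val_inZp_exp mulnC.
Qed.

Lemma eqr_mod_residue x y k : eqr_mod (p ^ k.+1) x y -> x k = y k.
Proof.
case=> z e; apply/eqP; rewrite -subr_eq0; apply/eqP/val_inj.
by rewrite -[LHS]/(val ((x - y) k)) e residue_natM modnMr.
Qed.

Lemma residue_eqr_mod x y k : x k = y k -> eqr_mod (p ^ k.+1) x y.
Proof.
move=> exy; set d : padic_int p := x - y.
have {exy} d0 : val (d k) = 0%N by rewrite -[d k]/(x k - y k) exy subrr.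
have dv j : (p ^ k.+1 %| val (d (j + k.+1)))%N.
  apply/eqP; rewrite -residue_mod ?d0 //.
  by rewrite (leq_trans (leqnSn k)) ?leq_addl.
(* Dividing by [p ^ k.+1] loses k + 1 digits: level [j + k.+1] has modulus [p ^ (j.+1 + k.+1)], so
   its quotient is defined modulo [p ^ j.+1]. *)
pose z j : 'Z_(p ^ j.+1) := inZp (val (d (j + k.+1)) %/ p ^ k.+1)%N.
have pk_gt0 : (0 < p ^ k.+1)%N by rewrite expn_gt0 ltnW.
have cz j : padic_red (z j.+1) = z j.
  apply/val_inj; rewrite !val_inZp_exp modn_dvdm ?dvdn_exp2l //.
  have -> : val (d (j + k.+1)%N) =
      (val (d (j.+1 + k.+1)) %% p ^ (j.+1 + k.+1))%N.
    exact: residue_mod (leqnSn _).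
  case/dvdnP: (dv j.+1) => a ->.
  by rewrite expnD -muln_modl !mulnK ?modn_mod.
exists (PadicInt cz); apply: padic_intP => j; apply/val_inj.
rewrite residue_natM val_inZp_exp modnMmr mulnC divnK //.
by rewrite -residue_mod ?leq_addr.
Qed.

Lemma padic_separated_int : padic_separated (padic_int p) p.
Proof. by move=> x hx; apply: padic_intP => k; exact: eqr_mod_residue. Qed.

(** Each residue of a Cauchy sequence is eventually constant, and the stable values form the
    limit. *)
Lemma padic_complete_int : padic_complete (padic_int p) p.
Proof.
move=> u /choice[L hL].
pose s k := u (L k.+1) k.
have hs k l : (L k.+1 <= l)%N -> u l k = s k.
  by move=> /hL; exact: eqr_mod_residue.
have cs k : padic_red (s k.+1) = s k.
  (* Past both thresholds, a single term [u l] carries both stable residues, so its compatibility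
     passes to [s]. *)
  pose l := maxn (L k.+1) (L k.+2).
  rewrite -(hs k l) ?leq_maxl // -(hs k.+1 l) ?leq_maxr //.
  exact: residue_compat.
exists (PadicInt cs) => -[|k].
  by exists 0%N => l _; exists (u l - PadicInt cs); rewrite mul1r.
by exists (L k.+1) => l /hs e; exact: residue_eqr_mod.
Qed.

End PadicInt.

(** * Entrywise transfer to matrices *)

Section Matrices.
Variables (R : comNzRingType) (p n : nat).

Lemma eqr_mod_mx m (A B : 'M[R]_n) :
  eqr_mod m A B <-> forall i j, eqr_mod m (A i j) (B i j).
Proof.
split=> [[C e] i j|h].
  exists (C i j); move/matrixP/(_ i j): e.
  by rewrite !mulr_natl mulmxnE !mxE.
have /choice[C e] ij : exists z, A ij.1 ij.2 - B ij.1 ij.2 = m%:R * z.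
  exact: h.
exists (\matrix_(i, j) C (i, j)); apply/matrixP => i j.
by rewrite mulr_natl mulmxnE !mxE (e (i, j)) mulr_natl.
Qed.

Lemma padic_separated_mx :
  padic_separated R p -> padic_separated 'M[R]_n p.
Proof.
move=> sepR A hA; apply/matrixP => i j; rewrite mxE; apply: sepR => k.
by have /eqr_mod_mx/(_ i j) := hA k; rewrite mxE.
Qed.

Lemma padic_complete_mx : padic_complete R p -> padic_complete 'M[R]_n p.
Proof.
move=> compR u hu.
have /choice[a ha] (ij : 'I_n * 'I_n) :
    exists a, padic_cvg p (fun l => u l ij.1 ij.2) a.
  apply: compR => k; have [L hL] := hu k; exists L => l /hL.
  by move=> /eqr_mod_mx; apply.
exists (\matrix_(i, j) a (i, j)) => k.
have /choice[L hL] ij := ha ij k.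
(* Finitely many entries allow a common threshold. *)
exists (\max_ij L ij) => l hl; apply/eqr_mod_mx => i j; rewrite mxE.
by apply: (hL (i, j)); apply: leq_trans hl; exact: leq_bigmax.
Qed.

End Matrices.

Theorem theorem5p5 (p n : nat) (p_prime : prime p) (n_ge1 : (1 <= n)%N)
    (M N : {fps 'M[padic_int p]_n})
    (M_restricted : M \in restricted 'M[padic_int p]_n p)
    (N_restricted : N \in restricted 'M[padic_int p]_n p)
    (X : 'M[padic_int p]_n) :
  let eqn (U : {fps 'M[padic_int p]_n}) (X' : 'M[padic_int p]_n) :=
    (fpsC X + fpsX + p%:R * fpsX ^+ 2 * M) * U
      = fpsC X' + fpsX + p%:R * fpsX ^+ 2 * N in
  (exists! UX' : {fps 'M[padic_int p]_n} * 'M[padic_int p]_n,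
     UX'.1 \in restricted 'M[padic_int p]_n p /\ eqn UX'.1 UX'.2) /\
  (forall (U : {fps 'M[padic_int p]_n}) (X' : 'M[padic_int p]_n),
     U \in restricted 'M[padic_int p]_n p -> eqn U X' ->
     (exists2 V, V \in restricted 'M[padic_int p]_n p & U = 1 + p%:R * V) /\
     eqr_mod p X' X).
Proof.
have p_gt1 := prime_gt1 p_prime.
have sepA := @padic_separated_mx _ p n (padic_separated_int p_gt1).
have compA := @padic_complete_mx _ p n (padic_complete_int p_gt1).
move=> eqn; split=> [|U X' rU /fps_eqn_coef[<- eU]].
  have [U rU eU] := fps_eqn_exists sepA compA X M_restricted N_restricted.
  exists (U, X * fpcoef U 0); split=> [|[W X'] /= [rW /fps_eqn_coef[<- eW]]].
    by split=> //; apply/fps_eqn_coef.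
  by rewrite (fps_eqn_uniq sepA rU rW eU eW).
have [V rV eV] := fps_eqn_mod sepA compA M_restricted N_restricted rU eU.
split; first by exists V.
(* From X' = X U_0 and U_0 = 1 + p V_0, the difference X' - X is p X V_0. *)
exists (X * fpcoef V 0).
rewrite eV -[fpcoef _ 0]/(1 + fpcoef (p%:R * V) 0) fpcoef_natM.
by rewrite mulrDr mulr1 addrC addKr !mulrA mulr_natl mulr_natr.
Qed.
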